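(* Let $p$ be a minimal idempotent in $(\beta\mathbb{N}, +)$, let $\langle B_n \rangle_{n=1}^\infty$ be a sequence of members of $p$, let $\langle A_n \rangle_{n=1}^\infty$ be a sequence of finite image partition regular matrices with entries from $\mathbb{Q}$, and let $m_n$ be the number of columns of $A_n$ for each $n \in \mathbb{N}$. Then for each $n \in \mathbb{N}$ there exists $\vec{x}_n \in \mathbb{N}^{m_n}$ such that for every nonempty finite $F \subseteq \mathbb{N}$, $\sum_{n \in F} Y_n \subseteq B_{\min F}$, where $Y_n$ denotes the set of entries of $A_n \vec{x}_n$.
   Context: $\beta\mathbb{N}$ is the Stone–Čech compactification of the discrete space $\mathbb{N}$ (the set of ultrafilters on $\mathbb{N}$), with the extension of addition given by $p+q = \{A \subseteq \mathbb{N} : \{x : -x+A \in q\} \in p\}$, where $-x+A=\{y: x+y\in A\}$; this makes $\beta\mathbb{N}$ a compact right topological semigroup. A minimal idempotent is an idempotent lying in the smallest two-sided ideal $K(\beta\mathbb{N})$. A finite $u\times v$ matrix $A$ with rational entries is image partition regular (over $\mathbb{N}$) if for every finite coloring of $\mathbb{N}$ there is $\vec{x}\in\mathbb{N}^v$ such that all entries of $A\vec{x}$ are in $\mathbb{N}$ and have the same color. For a finite $F \subseteq \mathbb{N}$ and nonempty sets $Y_n$ ($n\in F$), $\sum_{n \in F} Y_n = \{\sum_{n \in F} a_n : a_n \in Y_n \text{ for each } n \in F\}$. *)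

(* Defs.v *)
From HB Require Import structures.
From mathcomp Require Import all_boot all_order all_algebra.
Set Implicit Arguments. Unset Strict Implicit. Unset Printing Implicit Defensive.
Import Order.TTheory GRing.Theory Num.Theory.

(* A subset of N = {1,2,...} is represented by a predicate on nat; only its
   positive elements matter.  A point of beta N is a bNfam of such sets.    *)
Definition bNfam := (nat -> Prop) -> Prop.

(* p is an ultrafilter on N = {1,2,...} (viewed as an ultrafilter on nat
   containing the set of positive integers). *)
Definition is_ultrafilter (p : bNfam) : Prop :=
  [/\ p (fun x => 0 < x),
      ~ p (fun _ => False),
      (forall A B : nat -> Prop, p A -> (forall x, A x -> B x) -> p B),
      (forall A B : nat -> Prop, p A -> p B -> p (fun x => A x /\ B x)) &
      (forall A : nat -> Prop, p A \/ p (fun x => ~ A x))].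

Definition shiftset (x : nat) (A : nat -> Prop) : nat -> Prop :=
  fun y => A (x + y).

Definition usum (p q : bNfam) : bNfam :=
  fun A => p (fun x => q (shiftset x A)).

Definition bN_ideal (I : bNfam -> Prop) : Prop :=
  [/\ (forall q, I q -> is_ultrafilter q),
      (exists q, I q) &
      (forall q r, is_ultrafilter q -> is_ultrafilter r -> I r ->
         I (usum q r) /\ I (usum r q))].

(* membership in the smallest two-sided ideal K(beta N), i.e. in the
   intersection of all two-sided ideals *)
Definition in_K (p : bNfam) : Prop :=
  forall I, bN_ideal I -> I p.

Definition minimal_idempotent (p : bNfam) : Prop :=
  [/\ is_ultrafilter p, usum p p = p & in_K p].

Definition mxapp (u v : nat) (A : 'M[rat]_(u, v)) (x : 'I_v -> nat) (i : 'I_u)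
  : rat := (\sum_(j < v) A i j * (x j)%:R)%R.

Definition image_partition_regular (u v : nat) (A : 'M[rat]_(u, v)) : Prop :=
  forall (k : nat) (c : nat -> 'I_k),
  exists x : 'I_v -> nat, (forall j, 0 < x j) /\
  exists y : 'I_u -> nat,
    (forall i, 0 < y i /\ mxapp A x i = (y i)%:R%R) /\
    (forall i i', c (y i) = c (y i')).

Definition seqmin (F : seq nat) : nat := foldr minn (head 0 F) F.

(* Main.v *)
Require Import Defs.
From mathcomp Require Import all_boot all_order all_algebra.
From mathcomp Require Import boolp classical_sets filter.
From mathcomp Require Import zify ring lra.
Set Implicit Arguments. Unset Strict Implicit. Unset Printing Implicit Defensive.

Import Order.TTheory GRing.Theory Num.Theory.

(** Call [D] a J-set if for any finitely many sequences [y_i] some [a > 0] and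
    finite nonempty [H] satisfy [a + \sum_(t in H) y_i t \in D] for all [i].
    By a van der Waerden theorem for IP systems the non-J-sets do not cover N,
    so the ultrafilters whose members are all J-sets form a nonempty two-sided
    ideal; it contains [K(beta N)], hence [p].

    If [A] is image partition regular, colorings by the integer part of a
    logarithm in base [1 + 1/N] yield [x_N] for which any two entries of
    [A x_N] are nearly equal or of very different sizes. Compare the entries of
    [(x_N, A x_N)] as [N] tends to [p]. The projection of the column space
    of [(1; A)] to the coordinates that are not negligible with respect to a
    dominant one is linear, so approximate solutions can be corrected to an
    exact rational [w] that is [1] on the dominant entries of [A w], positive on
    the other dominant coordinates, and [0] on the negligible ones. Solving
    inductively for the negligible coordinates, with finite sums of the solutions
    [zeta_t] remaining solutions, and applying the J-set property to the dominant
    coordinates, a combination [(a + \sum_H M_t) w + \sum_H zeta_t] solves all of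
    them. So every member of [p] contains an image of [A], and the idempotence
    of [p] allows to choose such images successively with all sums controlled. *)

(** * A van der Waerden theorem for IP systems, by color focusing *)

Definition ipsum (y : nat -> nat) (H : seq nat) : nat := \sum_(t <- H) y t.

Lemma ipsum_cat y H1 H2 : ipsum y (H1 ++ H2) = ipsum y H1 + ipsum y H2.
Proof. by rewrite /ipsum big_cat. Qed.

Lemma ipsum_le y H N : uniq H -> {in H, forall t, t < N} ->
  ipsum y H <= \sum_(t < N) y t.
Proof.
move=> uH HN; rewrite -(big_mkord xpredT) /ipsum /index_iota subn0.
have /(perm_big _)-> : perm_eq H [seq t <- iota 0 N | t \in H].
  apply: uniq_perm => //; first exact/filter_uniq/iota_uniq.
  move=> t; rewrite mem_filter mem_iota /=.
  by case: (boolP (t \in H)) => // /HN ->.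
by rewrite big_filter /= big_mkcond; apply: leq_sum => t _; case: ifP.
Qed.

Definition mono_line (C : Type) (k : nat) (y : nat -> nat -> nat)
    (chi : nat -> C) (a : nat) (H : seq nat) (c : C) : Prop :=
  forall i, i < k -> chi (a + ipsum (y i) H) = c.

Definition fin_idx (N : nat) (H : seq nat) : Prop :=
  [/\ uniq H, H != [::] & {in H, forall t, t < N}].

Lemma fin_idxW N N' H : N <= N' -> fin_idx N H -> fin_idx N' H.
Proof. by move=> le [? ? h]; split=> // t /h /leq_trans; apply. Qed.

Lemma fin_idx_shift N N' H : fin_idx N' H -> fin_idx (N + N') (map (addn N) H).
Proof.
case=> uH nH hH; split.
- by rewrite map_inj_uniq // => a b /addnI.
- by case: H nH {uH hH}.
- by move=> _ /mapP[t /hH ? ->]; rewrite ltn_add2l.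
Qed.

Lemma fin_idx_cat N N' H H' : fin_idx N H -> fin_idx N' H' ->
  fin_idx (N + N') (H ++ map (addn N) H').
Proof.
move=> [uH nH hH] /(fin_idx_shift N)[uH' nH' hH']; split.
- rewrite cat_uniq uH uH' andbT /=; apply/hasPn => _ /mapP[t _ ->].
  by apply/negP => /hH; rewrite ltnNge leq_addr.
- by case: (H) nH.
- move=> t; rewrite mem_cat => /orP[/hH/ltn_addr->//|/hH'//].
Qed.

(** [N] is chosen before the coloring [chi]; this uniformity gives the windows in [focusing] a fixed
    length. *)
Definition ip_vdw_at k := forall (C : finType) (y : nat -> nat -> nat),
  exists N, forall chi : nat -> C, exists a H c,
    [/\ a < N, fin_idx N H & mono_line k y chi a H c].

(* [m] lines, with pairwise distinct colors on the first [k] sequences, that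
   all meet in [f] on the last one. *)
Definition focused (C : eqType) k y N (chi : nat -> C) m f
    (ls : seq (nat * seq nat * C)) : Prop :=
  [/\ size ls = m, uniq (map snd ls), f < N &
    forall a H c, (a, H, c) \in ls ->
      [/\ a < N, fin_idx N H, a + ipsum (y k) H = f & mono_line k y chi a H c]].

(** Induction on [m]: the hypothesis for [k] sequences, applied to window colorings, gives the known
    lines translates of equal colors, and the old focus starts one more line. *)
Lemma focusing k : ip_vdw_at k ->
  forall (C : finType) y m, exists N, forall chi : nat -> C,
    (exists a H c, [/\ a < N, fin_idx N H & mono_line k.+1 y chi a H c]) \/
    (exists f ls, focused k y N chi m f ls).
Proof.
move=> IHk C y; elim=> [|m [N HN]].
  by exists 1 => chi; right; exists 0, [::]; split.
(* Coloring by windows of length [W] makes the [m] inner lines look alike at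
   all the translates [b + ipsum (y i) K], [i < k]. *)
pose T M := \sum_(i < k.+1) \sum_(t < M) y i t.
have leT i H M : i <= k -> fin_idx M H -> ipsum (y i) H <= T M.
  move=> ik [uH _ hH]; apply: leq_trans (ipsum_le _ uH hH) _.
  rewrite /T (bigD1 (Ordinal (ik : i < k.+1))) //=; exact: leq_addr.
pose W := N + T N.
have [N' HN'] := IHk {ffun 'I_W -> C} (fun i t => y i (N + t)).
pose N2 := N + N' + T (N + N').
exists N2 => chi.
have [b [H' [g [bN' fH' mono']]]] :=
  HN' (fun x => [ffun s : 'I_W => chi (x + s)]).
pose K := map (addn N) H'.
have KE i : ipsum (fun t => y i (N + t)) H' = ipsum (y i) K.
  by rewrite /ipsum /K big_map.
have fK : fin_idx (N + N') K by exact: fin_idx_shift.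
have {}mono' i s : i < k -> s < W ->
    chi (b + ipsum (y i) K + s) = chi (b + ipsum (y 0) K + s).
  move=> ik sW.
  have k0 : 0 < k by case: (k) ik.
  have := mono' _ ik; rewrite -(mono' _ k0) !KE.
  by move=> /ffunP/(_ (Ordinal sW)); rewrite !ffunE.
pose B := b + ipsum (y 0) K.
have BN : N + B <= N2.
  rewrite /B addnA /N2 leq_add //; first by rewrite leq_add2l ltnW.
  exact: leT.
have NN2 : N <= N2 by rewrite (leq_trans _ BN) // leq_addr.
have full a H c : a < N -> fin_idx N H ->
    mono_line k.+1 y (fun x => chi (B + x)) a H c ->
    exists a H c, [/\ a < N2, fin_idx N2 H & mono_line k.+1 y chi a H c].
  move=> aN fH mon; exists (B + a), H, c; split.
  - by apply: leq_trans BN; rewrite addnC ltn_add2r.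
  - exact: fin_idxW fH.
  - by move=> i ik; rewrite -addnA; apply: mon.
case: (HN (fun x => chi (B + x))) => [[a [H [c [? ? ?]]]]|].
  by left; apply: full; eassumption.
move=> [f [ls [sls uls fN hls]]].
(* If the color of the focus already occurs, the line of that color extends to the sequence [k];
   otherwise all lines are prolonged by [K], and [K] itself gives a line of the new color. *)
case: (boolP (chi (B + f) \in map snd ls)) => [/mapP[[[a H] c] lin /= cE]|fresh].
  left; have [aN fH fE mon] := hls _ _ _ lin.
  apply: (full a H c) => // i; rewrite ltnS leq_eqVlt => /orP[/eqP->|/mon//].
  by rewrite fE.
right; exists (b + f + ipsum (y k) K).
exists ((b + f, K, chi (B + f))
  :: [seq (b + l.1.1, l.1.2 ++ K, l.2) | l <- ls]); split.
- by rewrite /= size_map sls.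
- by rewrite /= -map_comp /= fresh.
- rewrite /N2 -addSn leq_add ?leT // addnC -addSn.
  by rewrite leq_add // ltnW.
- have NN'2 : N + N' <= N2 by apply: leq_addr.
  have bx x : x < N -> b + x < N2.
    move=> xN; apply: leq_trans NN'2; rewrite addnC -addSn leq_add // ltnW //.
  move=> a H c; rewrite inE => /orP[/eqP[-> -> ->]|/mapP[[[a' H'' ] c'] lin]].
    split=> //; [exact: bx|exact: fin_idxW fK|].
    move=> i ik; rewrite addnAC mono' // /W.
    by rewrite (leq_trans fN) ?leq_addr.
  move=> [-> -> ->]; have [aN fH fE mon] := hls _ _ _ lin; split.
  + exact: bx.
  + by apply: fin_idxW NN'2 _; apply: fin_idx_cat.
  + by rewrite /= ipsum_cat addnA -(addnA b) fE.
  + move=> i ik; rewrite /= ipsum_cat -(mon i ik) /B.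
    rewrite addnA -(addnA b) addnAC mono' //.
    by rewrite /W -addSn leq_add // leT // ltnW.
Qed.

Lemma ip_vdw k : ip_vdw_at k.
Proof.
elim: k => [|k IHk] C y.
  by exists 1 => chi; exists 0, [:: 0], (chi 0); split=> //; split=> // t;
    rewrite inE => /eqP->.
(* More lines than colors cannot have pairwise distinct colors. *)
have [N HN] := focusing IHk C y #|C|.+1.
exists N => chi; case: (HN chi) => [//|[f [ls [sls uls _ _]]]].
by have := max_card (mem (map snd ls)); rewrite (card_uniqP uls) size_map sls ltnn.
Qed.

(** * J-sets and the smallest ideal *)

Definition J_set (D : nat -> Prop) : Prop := forall k (y : nat -> nat -> nat),
  exists a H, [/\ 0 < a, uniq H, H != [::] &
    forall i, i < k -> D (a + ipsum (y i) H)].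

(** If every [D l] fails on some finite family of sequences, [ip_vdw] is applied to all these
    families together, with [chi] choosing a class for each point; the color obtained belongs to a
    class that does not fail. *)
Lemma J_set_cover (T : finType) (D : T -> nat -> Prop) :
  (forall x, exists l, D l x) -> exists l, J_set (D l).
Proof.
move=> /choice[chi chiP]; apply: contrapT => /forallNP nJ.
have {nJ} /choice[k /choice[y nJ]] l : exists k y, forall a H, 0 < a ->
    uniq H -> H != [::] -> ~ (forall i, i < k -> D l (a + ipsum (y i) H)).
  have /existsNP[k /existsNP[y h]] := nJ l; exists k, y => a H a0 uH nH hD.
  by apply: h; exists a, H.
(* All families are padded to the largest length and listed as one family [Y]. *)
pose I : finType := (T * 'I_(\max_l k l))%type.
pose Y (i : nat) : nat -> nat :=
  if insub i is Some o then let: (l, j) := @enum_val I predT o in y l j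
  else fun=> 0.
have YE l j : j < k l -> exists2 i, i < #|{: I}| & Y i = y l j.
  move=> /leq_trans/(_ (leq_bigmax l)) jK.
  exists (enum_rank ((l, Ordinal jK) : I)) => //.
  by rewrite /Y valK enum_rankK.
have [N HN] := @ip_vdw #|{: I}| T Y.
(* The shift by one turns the [a >= 0] of [ip_vdw] into the [a > 0] of a J-set. *)
have [a [H [c [_ [uH nH _] mono]]]] := HN (fun x => chi x.+1).
apply: (nJ c a.+1 H) => // j /YE[i iI <-].
by rewrite addSn -(mono i iI).
Qed.

Lemma usum_ultrafilter p q :
  is_ultrafilter p -> is_ultrafilter q -> is_ultrafilter (usum p q).
Proof.
move=> [p1 p2 p3 p4 p5] [q1 q2 q3 q4 q5]; rewrite /usum /shiftset; split.
- apply: (p3 _ _ p1) => x x0; apply: (q3 _ _ q1) => y _.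
  by rewrite ltn_addr.
- by move=> h; apply: p2; apply: p3 h _.
- by move=> A B pA AB; apply: p3 pA _ => x; move/q3; apply=> y /AB.
- by move=> A B pA pB; apply: p3 (p4 _ _ pA pB) _ => x [qA qB]; apply: q4.
- move=> A; case: (p5 (fun x => q (fun y => A (x + y)))) => h; [by left|right].
  apply: p3 h _ => x nq; by case: (q5 (fun y => A (x + y))).
Qed.

(** The sets whose complement is covered by finitely many non-J-sets form a filter, proper by
    [J_set_cover]; an ultrafilter above it contains only J-sets. *)
Lemma J_ultrafilter_exists :
  exists2 q, is_ultrafilter q & forall D, q D -> J_set D.
Proof.
pose F : set_system nat := fun A => exists (T : finType) (D : T -> nat -> Prop),
  (forall l, ~ J_set (D l)) /\ forall x, A x \/ exists l, D l x.
have FF : ProperFilter F.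
  split.
    move=> [T [D [nJ cov]]].
    have [|l Jl] := @J_set_cover T D; last exact: nJ Jl.
    by move=> x; case: (cov x).
  split.
  - by exists void, (fun _ _ => True); split=> [[]|]; left.
  - move=> A B [T [D [nJ cov]]] [T' [D' [nJ' cov']]].
    exists (T + T')%type,
      (fun l => match l with inl l => D l | inr l => D' l end).
    split=> [[]//|x].
    case: (cov x) => [Ax|[l Dl]]; last by right; exists (inl l).
    case: (cov' x) => [Bx|[l Dl]]; last by right; exists (inr l).
    by left.
  - move=> A B AB [T [D [nJ cov]]]; exists T, D; split=> // x.
    by case: (cov x) => [/AB|]; [left|right].
have [q [Uq Fq]] := ultraFilterLemma FF.
have qJ D : q D -> J_set D.
  move=> qD; apply: contrapT => nJ.
  have /Fq qnD : F (~` D)%classic.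
    exists unit, (fun=> D); split=> // x.
    by case: (pselect (D x)) => Dx; [right; exists tt|left].
  have : q (D `&` ~` D)%classic by apply: filterI.
  by rewrite setICr; apply: filter_not_empty.
exists q => //; split.
- case: (in_ultra_setVsetC (fun x => 0 < x : Prop) Uq) => // /qJ /(_ 1 (fun _ _ => 0)).
  move=> [a [H [a0 _ _ /(_ 0 isT)]]]; case.
  by rewrite ltn_addr.
- exact: filter_not_empty.
- by move=> A B qA AB; apply: filterS qA.
- by move=> A B qA qB; apply: filterI.
- by move=> A; apply: in_ultra_setVsetC.
Qed.

Lemma ultrafilter_bigI p : is_ultrafilter p -> forall k (A : nat -> nat -> Prop),
  (forall i, i < k -> p (A i)) -> p (fun x => forall i, i < k -> A i x).
Proof.
move=> [p1 _ p3 p4 _] k A; elim: k => [_|k IH h]; first exact: p3 p1 _.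
have /IH pk : forall i, i < k -> p (A i) by move=> i /ltnW/h.
apply: p3 (p4 _ _ pk (h k (ltnSn k))) _ => x [h1 h2] i.
by rewrite ltnS leq_eqVlt => /orP[/eqP->|/h1].
Qed.

Lemma ultrafilter_ex p : is_ultrafilter p -> forall A, p A -> exists x, A x.
Proof.
move=> [_ p2 p3 _ _] A pA; apply: contrapT => /forallNP nA.
by apply: p2; apply: p3 pA nA.
Qed.

(** For [usum q r], some shift of [D] lies in [r], and a solution for this J-set is translated. For
    [usum r q], the J-set lies in [r] and consists of the [x] with [shiftset x D] in [q]; finitely
    many such shifts have a common point. *)
Lemma in_K_J_set p : in_K p -> forall D, p D -> J_set D.
Proof.
move=> /(_ (fun q => is_ultrafilter q /\ forall D, q D -> J_set D)) [] //.
split=> [q []//| |q r uq ur [_ Jr]].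
  by have [q uq Jq] := J_ultrafilter_exists; exists q.
split; (split; first exact: usum_ultrafilter).
  move=> D /(ultrafilter_ex uq)[x /Jr JD] k y.
  have [a [H [a0 uH nH h]]] := JD k y.
  exists (x + a), H; split=> //; first by rewrite addn_gt0 a0 orbT.
  by move=> i /h; rewrite /shiftset addnA.
move=> D /Jr JD k y; have [a [H [a0 uH nH h]]] := JD k y.
have /(ultrafilter_ex uq)[x hx] := ultrafilter_bigI uq h.
exists (a + x), H; split=> //; first by rewrite ltn_addr.
by move=> i /hx; rewrite /shiftset addnAC.
Qed.

(** * Pigeonhole, divisibility and finite sums for idempotent ultrafilters *)

Lemma ultrafilter_pigeonhole p : is_ultrafilter p ->
  forall (T : finType) (A : T -> nat -> Prop),
  p (fun x => exists t, A t x) -> exists t, p (A t).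
Proof.
move=> [p1 p2 p3 p4 p5] T A pA; apply: contrapT => /forallNP nA.
apply: (p2); suff h : forall s : seq T, p (fun x => forall t, t \in s -> ~ A t x).
  by apply: (p3) (p4 _ _ pA (h (enum T))) _ => x [[t At] /(_ t)]; apply;
    rewrite ?mem_enum.
elim=> [|t s IH]; first exact: p3 p1 _.
case: (p5 (A t)) => [/nA//|nAt].
by apply: (p3) (p4 _ _ nAt IH) _ => x [h1 h2] t'; rewrite inE => /orP[/eqP->|/h2].
Qed.

Lemma ultrafilter_bigI_fin p : is_ultrafilter p ->
  forall (T : finType) (A : T -> nat -> Prop),
  (forall t, p (A t)) -> p (fun x => forall t, A t x).
Proof.
move=> up T A pA; have [_ p2 p3 p4 p5] := up.
case: (p5 (fun x => forall t, A t x)) => // npA.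
have : p (fun x => exists t, ~ A t x) by apply: (p3) npA _ => x /existsNP.
move=> /(ultrafilter_pigeonhole up)[t nt].
by case: p2; apply: (p3) (p4 _ _ nt (pA t)) _ => x [].
Qed.

(** The residue modulo [d] selected by [p] satisfies [r + r = r], hence is zero. *)
Lemma idempotent_dvd p : is_ultrafilter p -> usum p p = p ->
  forall d, 0 < d -> p (fun x => d %| x).
Proof.
move=> up pp d d0; have [p1 p2 p3 p4 p5] := up.
have [|r pr] := @ultrafilter_pigeonhole p up 'I_d (fun r x => x %% d = r).
  by apply: (p3) p1 _ => x _; exists (Ordinal (ltn_pmod x d0)).
have : usum p p (fun x => x %% d = (r + r) %% d).
  apply: (p3 _ _ pr) => x xr; apply: (p3 _ _ pr) => y yr.
  by rewrite /shiftset -modnDm xr yr.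
rewrite pp => prr.
have [x [xr xrr]] := ultrafilter_ex up (p4 _ _ pr prr).
have r0 : r = 0 :> nat.
  have : r + r == r + 0 %[mod d] by rewrite addn0 -xrr -xr modn_mod.
  by rewrite eqn_modDl mod0n modn_small // => /eqP.
by apply: (p3) pr _ => y; rewrite r0 => /eqP.
Qed.

(** Positive multiples of [N.+1] exceed [N]. *)
Lemma idempotent_large p : is_ultrafilter p -> usum p p = p ->
  forall N, p (fun x => N < x).
Proof.
move=> up pp N; have [p1 p2 p3 p4 p5] := up.
apply: (p3) (p4 _ _ p1 (idempotent_dvd up pp (ltn0Sn N))) _ => x [x0 /dvdn_leq].
exact.
Qed.

Lemma seqmin_sorted (F : seq nat) n s : perm_eq F (n :: s) -> sorted ltn (n :: s) ->
  seqmin F = n.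
Proof.
move=> pF sns.
have le_n x : x \in F -> n <= x.
  rewrite (perm_mem pF) inE => /orP[/eqP->//|xs].
  by have := order_path_min ltn_trans sns => /allP/(_ _ xs)/ltnW.
have nF : n \in F by rewrite (perm_mem pF) mem_head.
have F0 : head 0 F \in F by case: (F) nF => //= a l _; rewrite mem_head.
rewrite /seqmin; apply/eqP; rewrite eqn_leq; apply/andP; split.
  elim: (F) nF (head 0 F) => //= a l IH; rewrite inE => /orP[/eqP<- d|/IH h d].
    exact: geq_minl.
  by rewrite (leq_trans (geq_minr _ _)).
suff h l d : d \in F -> {subset l <= F} -> n <= foldr minn d l by exact: h.
move=> dF; elim: l => [|a l IH] sub /=; first exact: le_n.
rewrite leq_min le_n ?sub ?mem_head //= IH // => x xl.
by apply: sub; rewrite inE xl orbT.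
Qed.

(** A Galvin-style choice of [X n]: its values lie in a member [D n] of [p] and shift [D n] to
    members of [p], and [D n.+1] is cut down to these shifts. The abstract [V] serves both the
    theorem and the sequence [zeta] of [solution_step]. *)
Lemma idempotent_FS p : is_ultrafilter p -> usum p p = p ->
  forall (T : nat -> Type) (V : forall n, T n -> seq nat),
  (forall n D, p D -> exists x, forall v, v \in V n x -> D v) ->
  forall B : nat -> nat -> Prop, (forall n, p (B n)) ->
  exists X : forall n, T n, forall F, uniq F -> F != [::] ->
    forall a, {in F, forall n, a n \in V n (X n)} ->
    B (seqmin F) (\sum_(n <- F) a n).
Proof.
move=> up pp T V hV B pB; have [p1 p2 p3 p4 p5] := up.
have star D : p D -> p (fun x => D x /\ p (shiftset x D)).
  by move=> pD; apply: p4 (pD) _; move: pD; rewrite -{1}pp.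
have choose n (D : {D | p D}) : {x | forall v, v \in V n x ->
    sval D v /\ p (shiftset v (sval D))}.
  by apply: cid; apply: hV; apply: star; case: D.
have pstep n (D : {D | p D}) : p (fun z => [/\ B n.+1 z, sval D z &
    forall v, v \in V n (sval (choose n D)) -> sval D (v + z)]).
  case: (choose n D) => x /= hx.
  have : p (fun z => forall v, v \in V n x -> sval D (v + z)).
    elim: (V n x) hx => [_|v s IH h]; first exact: p3 p1 _.
    have {}IH : p (fun z => forall v, v \in s -> sval D (v + z)).
      by apply: IH => w ws; apply: h; rewrite inE ws orbT.
    have [_ pv] := h v (mem_head _ _).
    apply: (p3) (p4 _ _ IH pv) _ => z [h1 h2] w.
    by rewrite inE => /orP[/eqP->|/h1].
  move=> pz; apply: (p3) (p4 _ _ (pB n.+1) (p4 _ _ (svalP D) pz)) _.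
  by move=> z [? []].
pose D := fix D n : {D | p D} := match n with
  | 0 => exist _ (B 0) (pB 0)
  | n.+1 => exist _ _ (pstep n (D n))
  end.
pose X n := sval (choose n (D n)).
have XP n v : v \in V n (X n) -> sval (D n) v by move=> /(svalP (choose n (D n)))[].
have DB n z : sval (D n) z -> B n z by case: n => [|n] //= [].
have DS n k z : n <= k -> sval (D k) z -> sval (D n) z.
  by move=> /subnK <-; elim: (k - n) => //= j IH [_ /IH].
exists X => F uF nF a aF.
have pF : perm_eq F (sort leq F) by rewrite perm_sym perm_sort.
have : sorted ltn (sort leq F).
  by rewrite ltn_sorted_uniq_leq sort_uniq uF sort_sorted //; exact: leq_total.
have {nF} : sort leq F != [::] by rewrite -size_eq0 size_sort size_eq0.
rewrite (perm_big _ pF) /=.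
have : {in sort leq F, forall n, a n \in V n (X n)} by move=> n; rewrite mem_sort => /aF.
case: (sort leq F) pF => // n s pF aV _ sns.
rewrite (seqmin_sorted pF sns); apply: (DB).
(* Sums are built from the largest index down: a tail lies in [D n.+1], so adding a value of [X n]
   leads into [D n]. *)
elim: s n sns aV {pF} => [|n' s IH] n /= sns aV.
  by rewrite big_seq1; apply/XP/aV/mem_head.
case/andP: sns => nn' sns; rewrite big_cons.
have /(DS n.+1) [//|_ _] := IH n' sns (fun x xs => aV x (@mem_behead _ [:: n, n' & s] x xs)).
by apply; apply/aV/mem_head.
Qed.

(** * From approximate solutions to an exact rational vector *)

Section Rational.
Local Open Scope ring_scope.

Lemma mulmx_col_bound m n (A : 'M[rat]_(m, n)) (e : 'cV[rat]_n) (eps : rat) :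
  (forall t, `|e t 0| <= eps) ->
  forall s, `|(A *m e) s 0| <= eps * \sum_t `|A s t|.
Proof.
move=> he s; rewrite mxE (le_trans (ler_norm_sum _ _ _)) // mulr_sumr.
by apply: ler_sum => t _; rewrite normrM mulrC ler_wpM2r.
Qed.

Section Level.
Variables (p : bNfam) (up : is_ultrafilter p) (large : forall N, p (fun x => N < x)%N).
(** In the application [M] is [col_mx 1%:M A], and [Y] selects the rows of [A]. *)
Variables (n v : nat) (M : 'M[rat]_(n, v)) (Y : pred 'I_n).
Variable xi : nat -> 'cV[rat]_v.
Let z N s := (M *m xi N) s 0.
Hypothesis z_gt0 : forall N s, 0 < z N s.
Hypothesis zY : forall N s s', Y s -> Y s' -> z N s <= z N s' ->
  N%:R * z N s' <= N.+1%:R * z N s \/ N%:R * z N s <= z N s'.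

(* Sizes are compared along [p]: this says [z N s / z N r] tends to [0]. *)
Definition negligible s r := forall eps : rat, 0 < eps ->
  p (fun N => z N s <= eps * z N r).

Lemma not_negligible s r : ~ negligible s r ->
  exists2 eps : rat, 0 < eps & p (fun N => eps * z N r < z N s).
Proof.
have [_ _ p3 _ p5] := up.
move=> /existsNP[eps /not_implyP[e0 h]]; exists eps => //.
case: (p5 (fun N => z N s <= eps * z N r)) => // h'.
by apply: (p3 _ _ h') => N /negP; rewrite -ltNge.
Qed.

(** The row that is largest along [p] is replaced, when possible, by a comparable row in [Y]; then
    [Y_ratio] applies to every non-negligible row of [Y]. *)
Lemma dominant_row (S : {set 'I_n}) s0 : s0 \in S -> exists r, exists2 C : rat, r \in S &
  p (fun N => forall s, s \in S -> z N s <= C * z N r) /\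
  forall s, s \in S -> Y s -> ~ negligible s r -> Y r.
Proof.
have [p1 p2 p3 p4 p5] := up.
move=> s0S.
have [|r pr] := ultrafilter_pigeonhole (A := fun r N => r \in S /\ forall s, s \in S ->
   z N s <= z N r) up.
  apply: (p3 _ _ p1) => N _.
  have [r rS rm] := arg_maxP (z N) s0S.
  by exists r; split.
have [_ [rS _]] := ultrafilter_ex up pr.
case: (pselect (exists s, [/\ s \in S, Y s & ~ negligible s r])) => [[s [sS Ys ns]]|nn].
  have [eps e0 pe] := not_negligible ns.
  exists s, eps^-1 => //; split=> //.
  apply: (p3 _ _ (p4 _ _ pr pe)) => N [[_ h] h'] s' /h /le_trans; apply.
  by rewrite mulrC ler_pdivlMr // mulrC ltW.
exists r, 1 => //; split.
  by apply: (p3 _ _ pr) => N [_ h] s /h; rewrite mul1r.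
by move=> s sS Ys ns; case: nn; exists s.
Qed.

(** For large [N], comparability excludes the second alternative of [zY], and the first one puts the
    ratio within [1 / N] of 1. *)
Lemma Y_ratio r s C : Y r -> Y s -> ~ negligible s r ->
  p (fun N => z N s <= C * z N r) ->
  forall eps, 0 < eps -> p (fun N => `|1 - z N s / z N r| <= eps).
Proof.
have [p1 p2 p3 p4 p5] := up.
move=> Yr Ys /not_negligible[d d0 pd] pC eps e0.
pose K := (Num.bound C + Num.bound d^-1 + Num.bound eps^-1)%N.
apply: (p3 _ _ (p4 _ _ (large K) (p4 _ _ pd pC))) => N [NK [hd hC]].
have [zs zr] := (z_gt0 N s, z_gt0 N r).
have bd (x : rat) : (Num.bound x <= K)%N -> x < N%:R.
  move=> xK; apply: (le_lt_trans (ler_norm x)).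
  apply: (lt_le_trans (archi_boundP (normr_ge0 x))).
  by rewrite ler_nat (leq_trans _ (ltnW NK)) //;
    move: xK; rewrite /Num.bound normr_id.
have NC : C < N%:R by apply: bd; rewrite /K -addnA leq_addr.
have Nd : d^-1 < N%:R by apply: bd; rewrite /K addnAC leq_addl.
have Ne : eps^-1 < N%:R by apply: bd; rewrite /K leq_addl.
have N0 : 0 < N%:R :> rat by apply: lt_trans Ne; rewrite invr_gt0.
have {}Nd : 1 < N%:R * d by rewrite -ltr_pdivrMr // mul1r.
have {}Ne : 1 < N%:R * eps by rewrite -ltr_pdivrMr // mul1r.
have hs : `|z N r - z N s| <= eps * z N r.
  have aux x : N%:R * x <= z N r -> x <= eps * z N r.
    move=> h; rewrite -(ler_pM2l N0) (le_trans h) // mulrA ler_peMl ?ltW //.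
  have S1 : N.+1%:R = N%:R + 1 :> rat by rewrite -addn1 natrD.
  have Nds : N%:R * d * z N r <= N%:R * z N s by rewrite -mulrA ler_pM2l // ltW.
  have dzr : z N r < N%:R * d * z N r by rewrite ltr_pMl.
  have NCr : C * z N r < N%:R * z N r by rewrite ltr_pM2r.
  case: (leP (z N r) (z N s)) => [le|/ltW le]; apply: aux.
    rewrite ler0_norm ?subr_le0 //; case: (zY Yr Ys le); rewrite ?S1; lra.
  rewrite ger0_norm ?subr_ge0 //; case: (zY Ys Yr le); rewrite ?S1; lra.
have -> : 1 - z N s / z N r = (z N r - z N s) / z N r.
  by rewrite mulrBl divff // gt_eqF.
by rewrite normrM normfV (ger0_norm (ltW zr)) ler_pdivrMr.
Qed.

Lemma level_vector (S : {set 'I_n}) s0 : s0 \in S ->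
  exists (w : 'cV[rat]_v) (S' : {set 'I_n}), [/\ S' \proper S,
    forall s, s \in S' -> (M *m w) s 0 = 0 &
    forall s, s \in S :\: S' -> 0 < (M *m w) s 0 /\ (Y s -> (M *m w) s 0 = 1)].
Proof.
have [p1 p2 p3 p4 p5] := up.
move=> s0S; have [r [C rS [pC rY]]] := dominant_row s0S.
pose neg s := `[< negligible s r >].
(* Exact values are prescribed on the rows [eq] only: 0 on negligible rows, 1 on the other rows of
   [Y]. Elsewhere in [S] positivity suffices, and it survives a small correction. *)
pose eq s := (s \in S) && (neg s || Y s).
pose t : 'cV[rat]_n := \col_s ([&& s \in S, ~~ neg s & Y s])%:R.
pose L := \matrix_(s, j) (if eq s then M s j else 0).
have LE s (x : 'cV_v) : (L *m x) s 0 = if eq s then (M *m x) s 0 else 0.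
  rewrite !mxE; case: ifP => es; last first.
    by apply: big1 => j _; rewrite mxE es mul0r.
  by apply: eq_bigr => j _; rewrite mxE es.
pose x N := (z N r)^-1 *: xi N.
have xE N s : (M *m x N) s 0 = z N s / z N r by rewrite -scalemxAr mxE mulrC.
pose e N := t - L *m x N.
have small eps : 0 < eps -> p (fun N => forall s, `|e N s 0| <= eps).
  move=> e0; apply: ultrafilter_bigI_fin => // s.
  have eE N : e N s 0 = ([&& s \in S, ~~ neg s & Y s])%:R - (L *m x N) s 0 by rewrite !mxE.
  case es: (eq s); last first.
    apply: (p3 _ _ p1) => N _; rewrite eE LE es.
    move: es; rewrite /eq; case: (s \in S) => //=; last by rewrite subr0 normr0 ltW.
    by case: (neg s) => //= ->; rewrite subr0 normr0 ltW.
  case/andP: (es) => sS; case: (boolP (neg s)) => [/asboolP ns _|/asboolPn nns /= Ys].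
    apply: (p3 _ _ (ns eps e0)) => N h; rewrite eE LE es xE /neg asboolT //= andbF sub0r normrN.
    by rewrite ger0_norm ?ler_pdivrMr // divr_ge0 // ltW.
  have pCs : p (fun N => z N s <= C * z N r) by apply: (p3 _ _ pC) => N /(_ s sS).
  apply: (p3 _ _ (Y_ratio (rY _ sS Ys nns) Ys nns pCs e0)) => N.
  by rewrite eE LE es xE sS Ys /neg asboolF.
(* [P] corrects [x N] by [P *m e N], which is arbitrarily small along [p], to an
   exact solution [u N] of [L *m u N = t]; such a solution exists because
   [L *m P *m t - t] is the image of [e N] under a fixed matrix. *)
pose P := pinvmx L.
have LPL : L *m P *m L = L by apply: mulmxKpV.
pose u N := x N + P *m e N.
have smallA m (A : 'M[rat]_(m, n)) eps : 0 < eps ->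
    p (fun N => forall s, `|(A *m e N) s 0| <= eps).
  move=> e0; pose K := 1 + \sum_s \sum_t `|A s t|.
  have K0 : 0 < K by rewrite ltr_pwDl // sumr_ge0 // => ? _; rewrite sumr_ge0.
  apply: (p3 _ _ (small (eps / K) _)); first exact: divr_gt0.
  move=> N h s; apply: le_trans (mulmx_col_bound A h s) _.
  rewrite mulrAC ler_pdivrMr // ler_pM2l // /K (bigD1 s) //= [_ + (_ + _)]addrCA lerDl.
  by rewrite addr_ge0 // sumr_ge0 // => ? _; rewrite sumr_ge0.
have LPt : L *m (P *m t) = t.
  have res N : L *m (P *m t) - t = (L *m P - 1%:M) *m e N.
    rewrite /e mulmxBr !mulmxBl !mul1mx [L *m P *m (L *m _)]mulmxA LPL !mulmxA.
    by rewrite subrr subr0.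
  apply/eqP; rewrite -subr_eq0; apply/eqP/matrixP => s j.
  rewrite ord1 [RHS]mxE; apply/eqP; rewrite -normr_le0; apply/ler_addgt0Pl => eps e0.
  have [N /(_ s)] := ultrafilter_ex up (smallA _ (L *m P - 1%:M) eps e0).
  by rewrite addr0 -res.
have Lu N : L *m u N = t.
  rewrite /u mulmxDr /e !mulmxBr LPt.
  by rewrite (mulmxA P) (mulmxA L) (mulmxA L P) LPL addrC subrK.
have pos s : s \in S -> ~~ neg s -> p (fun N => 0 < (M *m u N) s 0).
  move=> sS /asboolPn /not_negligible[d d0 pd].
  have d2 : 0 < d / 2 by rewrite divr_gt0.
  apply: (p3 _ _ (p4 _ _ pd (smallA _ (M *m P) _ d2))) => N [h /(_ s)].
  have -> : (M *m u N) s 0 = z N s / z N r + (M *m P *m e N) s 0.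
    by rewrite -xE -mulmxA /u mulmxDr [LHS]mxE.
  have {h}: d < z N s / z N r by rewrite ltr_pdivlMr.
  rewrite ler_norml => h /andP[h' _].
  move: h'; set q := (_ *m _) _ _; lra.
have [N hN] : exists N, forall s, s \in S -> ~~ neg s -> 0 < (M *m u N) s 0.
  apply: (@ultrafilter_ex p up); apply: ultrafilter_bigI_fin => // s.
  case: (boolP (s \in S)) => [sS|nS]; last by apply: (p3 _ _ p1).
  case: (boolP (neg s)) => [ns|nns]; first by apply: (p3 _ _ p1).
  by apply: (p3 _ _ (pos s sS nns)).
exists (u N), [set s in S | neg s]; split.
- rewrite properE; apply/andP; split; first by apply/fintype.subsetP => s; rewrite inE => /andP[].
  (* The row [r] is not negligible with respect to itself. *)
  apply/negP => /fintype.subsetP /(_ r rS); rewrite inE rS => /asboolP /(_ (1/2) isT) h.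
  have [N' /=] := ultrafilter_ex up h; have := z_gt0 N' r; lra.
- move=> s; rewrite inE => /andP[sS ns]; have := LE s (u N).
  by rewrite Lu /eq sS ns mxE ns andbF /= => <-.
- move=> s; rewrite !inE negb_and => /andP[/orP[/negP//|ns] sS]; split; first exact: hN.
  by move=> Ys; have := LE s (u N); rewrite Lu /eq sS Ys orbT mxE sS ns Ys.
Qed.

End Level.

(** * Integer solutions through the J-set property *)

Definition natval (x : rat) : nat := `|numq x|%N.

Lemma natval_nat (k : nat) : natval k%:R = k.
Proof. by rewrite /natval -[k%:R]/(k%:Z%:~R) numq_int. Qed.

Lemma int_ge0_natval (x : rat) : x \is a Num.int -> 0 <= x -> x = (natval x)%:R.
Proof.
move=> /intrP[k ->]; rewrite ler0z => k0.
by rewrite /natval numq_int -[LHS]/(k%:~R) -{1}(gez0_abs k0).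
Qed.

Lemma common_denominator n (f : 'I_n -> rat) :
  exists2 c : nat, (0 < c)%N & forall s, c%:R * f s \is a Num.int.
Proof.
exists (\prod_s `|denq (f s)|)%N; first by rewrite prodn_gt0 // => s; rewrite absz_gt0 denq_neq0.
move=> s; rewrite (bigD1 s) //= natrM mulrAC rpredM ?natr_int //.
have -> : `|denq (f s)|%:R = (denq (f s))%:~R :> rat.
  by rewrite -[RHS](congr1 (fun z : int => z%:~R) (gez0_abs (denq_ge0 (f s)))).
by rewrite mulrC -numqE intr_int.
Qed.

Section Image.
Variables (p : bNfam) (up : is_ultrafilter p) (pp : usum p p = p).
Hypothesis pJ : forall D, p D -> J_set D.
Variables (n v : nat) (M : 'M[rat]_(n, v)) (Y : pred 'I_n).

(** Divisibility by [d] is demanded in all rows, since those outside [S] are treated at a later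
    level with the same vectors. *)
Definition solution (d : nat) (D : nat -> Prop) (S : {set 'I_n}) (x : 'cV[rat]_v) :=
  (forall s, (M *m x) s 0 / d%:R \is a Num.int) /\
  forall s, s \in S -> 0 < (M *m x) s 0 /\ (Y s -> D (natval ((M *m x) s 0))).

Lemma solution_step (w : 'cV[rat]_v) (S S' : {set 'I_n}) :
  (forall s, s \in S' -> (M *m w) s 0 = 0) ->
  (forall s, s \in S :\: S' -> 0 < (M *m w) s 0 /\ (Y s -> (M *m w) s 0 = 1)) ->
  (forall d D, (0 < d)%N -> p D -> exists x, solution d D S' x) ->
  forall d D, (0 < d)%N -> p D -> exists x, solution d D S x.
Proof.
have [p1 p2 p3 p4 p5] := up.
move=> w0 wpos IH d0 D d0_gt0 pD.
have [c c0 cw] := common_denominator (fun s => (M *m w) s 0).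
(* The factor [c] clears the denominators of [M *m w], so that multiples of [d] times [w] have
   entries divisible by [d0]. *)
pose d := (d0 * c)%N; have d_gt0 : (0 < d)%N by rewrite muln_gt0 d0_gt0.
have dN0 : d%:R != 0 :> rat by rewrite pnatr_eq0 -lt0n.
have d0N0 : d0%:R != 0 :> rat by rewrite pnatr_eq0 -lt0n.
pose T := {x | solution d xpredT S' x}.
pose V (x : T) := [seq natval ((M *m sval x) s 0) | s <- enum S' & Y s].
(* All finite sums of the chosen solutions keep their [Y]-entries on [S'] in [D]. *)
have [|X XFS] := @idempotent_FS p up pp (fun=> T) (fun=> V) _ (fun=> D) (fun=> pD).
  move=> _ D' /(IH _ _ d_gt0)[x [xd xD]].
  have xs : solution d xpredT S' x by split=> // s /xD[].
  exists (exist _ x xs) => _ /mapP[s + ->]; rewrite mem_filter mem_enum => /andP[Ys sS'].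
  by have [_] := xD s sS'; apply.
pose zeta t := sval (X t); pose z t s := (M *m zeta t) s 0.
have zd t s : z t s / d%:R \is a Num.int by case: (svalP (X t)) => h _; exact: h.
have zint t s : z t s \is a Num.int.
  by rewrite -[z t s](divfK dN0) rpredM ?natr_int.
have zpos t s : s \in S' -> 0 < z t s.
  by case: (svalP (X t)) => _ h /h[].
(* Adding multiples of [w] makes the sequences for the J-set nonnegative; the
   zero sequence [y n] forces [a] itself to be a multiple of [d]. *)
have /choice[K hK] : forall t, exists k, forall s, s \in S :\: S' ->
    0 <= z t s + (d * k)%:R * (M *m w) s 0.
  move=> t.
  exists (\sum_s Num.bound `|z t s / (M *m w) s 0|%R)%N => s sS.
  have [ws _] := wpos s sS; rewrite addrC -lerBlDr sub0r -ler_pdivrMr // mulNr.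
  set q := z t s / _.
  have qb : `|q| < (Num.bound `|q|)%:R by exact: archi_boundP.
  rewrite (le_trans (ler_norm _)) // normrN (le_trans (ltW qb)) // ler_nat.
  rewrite (bigD1 s) //= -/q; apply: leq_trans (leq_addr _ _) _; exact: leq_pmull.
pose y i t := if insub i is Some s then
  if (s \in S :\: S') && Y s then natval (z t s + (d * K t)%:R) else 0%N else 0%N.
have pDd : p (fun a => D a /\ (d %| a)%N) by apply: p4 => //; apply: idempotent_dvd.
have [a [H [a0 uH nH ha]]] := pJ pDd n.+1 y.
have [Da da] : D a /\ (d %| a)%N.
  have := ha n (ltnSn n); rewrite /ipsum big1 ?addn0 // => t _.
  by rewrite /y insubF // ltnn.
pose A := (a + \sum_(t <- H) d * K t)%N.
pose x := A%:R *: w + \sum_(t <- H) zeta t.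
have xE s : (M *m x) s 0 = A%:R * (M *m w) s 0 + \sum_(t <- H) z t s.
  by rewrite /x mulmxDr -scalemxAr mulmx_sumr !mxE summxE.
have dA : (d %| A)%N by rewrite dvdn_add // dvdn_sum // => t _; rewrite dvdn_mulr.
have xE' s : (M *m x) s 0 = a%:R * (M *m w) s 0 +
    \sum_(t <- H) (z t s + (d * K t)%:R * (M *m w) s 0).
  by rewrite xE /A natrD mulrDl -addrA big_split /= -mulr_suml natr_sum [X in _ + X]addrC.
have xint s : (M *m x) s 0 / d0%:R \is a Num.int.
  rewrite xE mulrDl rpredD //.
    have /dvdnP[k ->] := dA; rewrite /d !natrM.
    have -> : k%:R * (d0%:R * c%:R) * (M *m w) s 0 / d0%:R = k%:R * (c%:R * (M *m w) s 0).
      by field.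
    by rewrite rpredM ?natr_int.
  rewrite mulr_suml rpred_sum // => t _.
  have -> : z t s / d0%:R = z t s / d%:R * c%:R.
    rewrite /d natrM; field; by rewrite d0N0 pnatr_eq0 -lt0n c0.
  by rewrite rpredM ?natr_int.
have sum_gt0 (f : nat -> rat) : (forall t, 0 < f t) -> 0 < \sum_(t <- H) f t.
  move=> f0; case: H nH {uH ha A x xE dA xE' xint} => // t H _.
  by rewrite big_cons ltr_wpDr // sumr_ge0 // => ? _; rewrite ltW.
(* On [S'] the vector [w] contributes nothing and only the sum of the [zeta t] remains; on the rows
   of [Y] in [S :\: S'], where [M *m w] is 1, the entry is [a + ipsum (y s) H]. *)
exists x; split=> // s sS; case: (boolP (s \in S')) => sS'.
  have {}xE : (M *m x) s 0 = \sum_(t <- H) z t s by rewrite xE w0 // mulr0 add0r.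
  split; first by rewrite xE sum_gt0 // => t; apply: zpos.
  move=> Ys; rewrite xE.
  under eq_bigr => t _ do rewrite (int_ge0_natval (zint t s) (ltW (zpos t s sS'))).
  rewrite -natr_sum natval_nat.
  have zV t : t \in H -> natval (z t s) \in V (X t).
    move=> _; rewrite /V; apply/mapP; exists s; last by [].
    by rewrite mem_filter mem_enum sS' andbT.
  exact: (XFS H uH nH (fun t => natval (z t s)) zV).
have sSS : s \in S :\: S' by rewrite inE sS'.
have [ws w1] := wpos s sSS.
split.
  rewrite xE' ltr_pwDl ?mulr_gt0 ?ltr0n // sumr_ge0 // => t _; exact: hK.
move=> Ys; have := ha s (ltn_trans (ltn_ord s) (ltnSn n)); rewrite xE' w1 // mulr1.
rewrite (eq_bigr (fun t => (y s t)%:R)) => [|t _].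
  by rewrite -natr_sum -natrD natval_nat => -[].
rewrite /y valK sSS Ys /= mulr1; apply: int_ge0_natval.
  by rewrite rpredD ?natr_int.
by have := hK t s sSS; rewrite w1 // mulr1.
Qed.

Lemma solution_exists (xi : nat -> 'cV[rat]_v) :
  (forall N s, 0 < (M *m xi N) s 0) ->
  (forall N s s', Y s -> Y s' -> (M *m xi N) s 0 <= (M *m xi N) s' 0 ->
    N%:R * (M *m xi N) s' 0 <= N.+1%:R * (M *m xi N) s 0 \/
    N%:R * (M *m xi N) s 0 <= (M *m xi N) s' 0) ->
  forall S d D, (0 < d)%N -> p D -> exists x, solution d D S x.
Proof.
move=> z0 zY S; have [k] := ubnP #|S|; elim: k S => // k IH S.
rewrite ltnS => Sk.
have [->|[s0 s0S]] := set_0Vmem S.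
  move=> d D _ _; exists 0; split=> s; last by rewrite inE.
  by rewrite mulmx0 mxE mul0r.
have [w [S' [S'S w0 wpos]]] := level_vector up (idempotent_large up pp) z0 zY s0S.
apply: solution_step w0 wpos _; apply: IH.
by rewrite (leq_trans (proper_card S'S)).
Qed.

End Image.

(** * Logarithmic colorings *)

(* [(1 + e / N) <= (1 + 1 / N) ^ e] with denominators cleared. *)
Lemma bernoulli N e : ((N + e) * N ^ e <= N * N.+1 ^ e)%N.
Proof.
elim: e => [|e IH]; first by rewrite addn0.
rewrite !expnS mulnCA [leqRHS]mulnCA.
apply: (@leq_trans (N.+1 * ((N + e) * N ^ e))); last by rewrite leq_mul2l IH orbT.
by rewrite [leqLHS]mulnA [leqRHS]mulnA leq_mul2r; apply/orP; right; nia.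
Qed.

Lemma scale_coloring N : exists k (c : nat -> 'I_k), forall a b, (0 < a)%N ->
  c a = c b -> (a <= b)%N -> (N * b <= N.+1 * a \/ N * a <= b)%N.
Proof.
case: (posnP N) => [->|N0]; first by exists 1%N, (fun=> ord0); left.
have NX e : (0 < N ^ e)%N by rewrite expn_gt0 N0.
(* [f a] is the integer part of the logarithm of [a] in base [1 + 1 / N]. *)
have /choice[f fP] a : exists e, (0 < a)%N -> (N.+1 ^ e <= a * N ^ e)%N /\
    forall e', (N.+1 ^ e' <= a * N ^ e' -> e' <= e)%N.
  case: (posnP a) => [->|a0]; first by exists 0%N.
  have ex0 : exists e, (N.+1 ^ e <= a * N ^ e)%N by exists 0%N; rewrite muln1.
  have bd e : (N.+1 ^ e <= a * N ^ e -> e <= N * a)%N.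
    move=> h; have := leq_trans (bernoulli N e) (leq_mul (leqnn N) h).
    by rewrite mulnA leq_pmul2r // => /(leq_trans _); apply; rewrite leq_addl.
  by case: (ex_maxnP ex0 bd) => e he hm; exists e.
(* Logarithms congruent modulo [m] are equal or at least [m] apart. One unit is lost to integer
   parts; by [bernoulli] the other [N * N] give a factor at least [N.+1]. *)
pose m := (N * N).+1.
exists m, (fun a => inord (f a %% m)) => a b a0 cab ab.
have b0 := leq_trans a0 ab.
have {}cab : f a = f b %[mod m].
  by move/(congr1 val): cab; rewrite /= !inordK // ltn_pmod.
have [fa1 fa2] := fP a a0; have [fb1 fb2] := fP b b0.
have fab : (f a <= f b)%N.
  by apply: fb2; rewrite (leq_trans fa1) // leq_mul2r ab orbT.
have next x e : (forall e', (N.+1 ^ e' <= x * N ^ e' -> e' <= e)%N) ->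
    (x * N ^ e.+1 < N.+1 ^ e.+1)%N.
  by move=> h; rewrite ltnNge; apply/negP => /h; rewrite ltnn.
have {}fa2 := next _ _ fa2; have {}fb2 := next _ _ fb2.
case: (ltngtP (f a) (f b)) fab => // [fab _|fab _]; [right|left]; last first.
  rewrite -(leq_pmul2r (NX (f a))).
  rewrite -fab !expnS in fb2.
  have := leq_mul (leqnn N.+1) fa1; nia.
have [j jN fbE] : exists2 j, (N * N <= j)%N & f b = ((f a).+1 + j)%N.
  have mj : (m %| f b - f a)%N by rewrite -eqn_mod_dvd ?(ltnW fab) // cab.
  have := dvdn_leq _ mj; rewrite subn_gt0 => /(_ fab) le.
  exists (f b - f a).-1; rewrite /m in le; lia.
have hj : (N.+1 * N ^ j <= N.+1 ^ j)%N.
  rewrite -(leq_pmul2l N0); apply: leq_trans (bernoulli N j).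
  by rewrite mulnA leq_mul2r; apply/orP; right; nia.
rewrite fbE !expnD in fb1.
rewrite -(leq_pmul2r (NX j)) -(leq_pmul2r (NX (f a).+1)).
have := leq_mul (ltnW fa2) hj.
move: (N ^ j)%N (N.+1 ^ j)%N (N ^ (f a).+1)%N (N.+1 ^ (f a).+1)%N fb1 => P Q R S h1 h2.
have {}h2 := leq_trans h2 h1; nia.
Qed.

(** * Images in the members of a minimal idempotent, and their successive choice *)

Lemma minimal_idempotent_image p : minimal_idempotent p ->
  forall u v (A : 'M[rat]_(u, v)), image_partition_regular A ->
  forall D, p D -> exists (x : 'I_v -> nat) (y : 'I_u -> nat),
    [/\ forall j, (0 < x j)%N,
        forall i, (0 < y i)%N /\ mxapp A x i = (y i)%:R & forall i, D (y i)].
Proof.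
move=> [up pp pK] u v A iprA D pD.
(* The identity block makes the coordinates of [x] entries of [M *m x], so that they too come out as
   positive integers. *)
pose M := col_mx 1%:M A.
pose vec (x : 'I_v -> nat) : 'cV[rat]_v := \col_j (x j)%:R.
have ME x : M *m x = col_mx x (A *m x) by rewrite mul_col_mx mul1mx.
have Mr (x : 'cV[rat]_v) i : (M *m x) (rshift v i) 0 = (A *m x) i 0.
  by rewrite ME col_mxEd.
have Ml (x : 'cV[rat]_v) j : (M *m x) (lshift u j) 0 = x j 0.
  by rewrite ME col_mxEu.
have Avec x i : (A *m vec x) i 0 = mxapp A x i.
  by rewrite mxE; apply: eq_bigr => j _; rewrite mxE.
have /choice[X /choice[W XW]] N : exists (x : 'I_v -> nat) (y : 'I_u -> nat),
    [/\ forall j, (0 < x j)%N, forall i, (0 < y i)%N /\ mxapp A x i = (y i)%:R &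
    forall i i', (y i <= y i' -> N * y i' <= N.+1 * y i \/ N * y i <= y i')%N].
  have [k [c cP]] := scale_coloring N.
  have [x [x0 [y [yE yc]]]] := iprA k c.
  exists x, y; split=> // i i'; apply: cP => //; by have [] := yE i.
pose Y : pred 'I_(v + u) := fun s => (v <= s)%N.
have Yl j : Y (lshift u j) = false by rewrite /Y /= leqNgt ltn_ord.
have Yr i : Y (rshift v i) by rewrite /Y /= leq_addr.
have [||x [xint xpos]] := @solution_exists p up pp (in_K_J_set pK) _ _ M Y
    (fun N => vec (X N)) _ _ [set: 'I_(v + u)]%SET 1%N D isT pD.
- move=> N s; have [x0 yE _] := XW N; case: (split_ordP s) => [j|i] ->.
    by rewrite Ml mxE ltr0n.
  by rewrite Mr Avec; have [y0 ->] := yE i; rewrite ltr0n.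
- move=> N s s'; have [x0 yE yc] := XW N.
  case: (split_ordP s) => [j|i] -> ; first by rewrite Yl.
  case: (split_ordP s') => [j|i'] -> _; first by rewrite Yl.
  rewrite !Mr !Avec !(yE _).2 -!natrM !ler_nat => _; exact: yc.
have natE s : (M *m x) s 0 = (natval ((M *m x) s 0))%:R.
  apply: int_ge0_natval; first by have := xint s; rewrite divr1.
  by have [/ltW] := xpos s (finset.in_setT s).
have nat_gt0 s : (0 < natval ((M *m x) s 0%R))%N.
  by have [] := xpos s (finset.in_setT s); rewrite natE ltr0n natval_nat.
pose x' j := natval (x j 0).
have xE : x = vec x'.
  by apply/colP => j; rewrite mxE /x' -Ml -natE.
exists x', (fun i => natval ((A *m x) i 0)); split.
- by move=> j; rewrite /x' -Ml.
- by move=> i; rewrite -Mr; split; rewrite // -natE Mr xE Avec.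
- move=> i; rewrite -Mr; have [_] := xpos _ (finset.in_setT (rshift v i)).
  exact.
Qed.

End Rational.

Theorem theorem2p1
  (p : bNfam) (hp : minimal_idempotent p)
  (B : nat -> nat -> Prop) (hB : forall n, p (B n))
  (u m : nat -> nat) (A : forall n, 'M[rat]_(u n, m n))
  (hA : forall n, image_partition_regular (A n)) :
  exists X : forall n, 'I_(m n) -> nat,
    (forall n j, 0 < X n j) /\
    forall F : seq nat, uniq F -> F <> [::] ->
    forall a : nat -> rat,
      (forall n, n \in F -> exists i : 'I_(u n), a n = mxapp (A n) (X n) i) ->
      exists k : nat, 0 < k /\ (\sum_(n <- F) a n)%R = (k%:R)%R /\ B (seqmin F) k.
Proof.
(* The image is stored with the vector as natural numbers, the form in which [idempotent_FS] adds
   values. *)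
pose T n := {xy : ('I_(m n) -> nat) * ('I_(u n) -> nat) |
  (forall j, 0 < xy.1 j) /\
  forall i, 0 < xy.2 i /\ mxapp (A n) xy.1 i = ((xy.2 i)%:R)%R}.
pose V n (xy : T n) := [seq (sval xy).2 i | i <- enum 'I_(u n)].
have [up pp pK] := hp.
have [n D pD|X XFS] := @idempotent_FS p up pp T V _ B hB.
  have [x [y [x0 yE yD]]] := minimal_idempotent_image hp (hA n) pD.
  exists (exist _ (x, y) (conj x0 yE)) => _ /mapP[i _ ->]; exact: yD.
have XP n := svalP (X n).
exists (fun n => (sval (X n)).1); split=> [n j|F uF F0 a aE].
  by have [h _] := XP n; apply: h.
(* [choice] needs a value for every [n]; outside [F] it is an arbitrary 0. *)
have /choice[b bP] n : exists k, n \in F ->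
    [/\ 0 < k, a n = (k%:R)%R & k \in V n (X n)].
  case: (boolP (n \in F)) => [nF|]; last by exists 0.
  have [i ai] := aE n nF; have [_ h] := XP n; have [y0 yE] := h i.
  exists ((sval (X n)).2 i) => _; split=> //; first by rewrite ai.
  by apply/mapP; exists i; rewrite ?mem_enum.
exists (\sum_(n <- F) b n); split; [|split].
- case: F F0 {uF aE} bP => // n F _ bP; rewrite big_cons ltn_addr //.
  by have [|//] := bP n; rewrite mem_head.
- rewrite natr_sum; apply: eq_big_seq => n /bP[_ -> //].
- apply: XFS => //; first exact/eqP.
  by move=> n /bP[].
Qed.
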